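(* Let $p(X_1,\dots,X_n)=a_1X_1+\cdots+a_nX_n$ be a homogeneous linear pattern with integer coefficients admitted by the numerical semigroup $\mathbb{Z}_+$, and let $I$ be an ideal of a numerical semigroup $S$. Then the image $p(I)$ is an ideal of some numerical semigroup if and only if $\gcd(a_1,\dots,a_n)=1$.
   Context: $\mathbb{Z}_+$ denotes the set of non-negative integers. A numerical semigroup is a subset of $\mathbb{Z}_+$ that contains $0$, is closed under addition and has finite complement in $\mathbb{Z}_+$. An ideal of a numerical semigroup $S$ is a nonempty subset $I\subseteq S$ with $I+S\subseteq I$. A pattern admitted by an ideal $I$ of $S$ is a polynomial $p(X_1,\dots,X_n)$ such that $p(s_1,\dots,s_n)\in S$ for every non-increasing sequence $s_1\ge\cdots\ge s_n$ of elements of $I$; a numerical semigroup $S$ admits $p$ if the ideal $I=S$ does. For a polynomial $p$ in $n$ indeterminates (not necessarily admitted by $I$), $p(I)=\{p(s_1,\dots,s_n): s_1\ge\cdots\ge s_n,\ s_i\in I\}$. *)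

(* Defs.v *)
From HB Require Import structures.
From mathcomp Require Import all_boot all_order all_algebra.
From mathcomp Require Import boolp classical_sets cardinality.
From mathcomp Require Import mpoly.

Set Implicit Arguments.
Unset Strict Implicit.
Unset Printing Implicit Defensive.

Import Order.TTheory GRing.Theory Num.Theory.

Local Open Scope classical_set_scope.
Local Open Scope ring_scope.

(* Semigroups and ideals are sets of integers contained in [Zplus], so that
   they and the values of a polynomial with integer coefficients, possibly
   negative, live in the same type. *)
Definition Zplus : set int := [set x | 0 <= x].

Definition numerical_semigroup (S : set int) : Prop :=
  [/\ S `<=` Zplus, S 0, (forall x y, S x -> S y -> S (x + y))
    & finite_set (Zplus `\` S)].

Definition ideal_of (S I : set int) : Prop :=
  [/\ I !=set0, I `<=` S & forall x y, I x -> S y -> I (x + y)].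

Definition nonincreasing_in (n : nat) (I : set int) (s : 'I_n -> int) : Prop :=
  (forall i, I (s i)) /\ (forall i j : 'I_n, (i <= j)%N -> s j <= s i).

Definition pattern_admitted_by (n : nat) (S I : set int)
    (p : {mpoly int[n]}) : Prop :=
  forall s : 'I_n -> int, nonincreasing_in I s -> S p.@[s].

Definition admits (n : nat) (S : set int) (p : {mpoly int[n]}) : Prop :=
  pattern_admitted_by S S p.

Definition pattern_image (n : nat) (p : {mpoly int[n]}) (I : set int) :
    set int :=
  [set p.@[s] | s in [set s : 'I_n -> int | nonincreasing_in I s]].

Definition linear_form (n : nat) (a : 'I_n -> int) : {mpoly int[n]} :=
  \sum_(i < n) a i *: 'X_i.

(* Main.v *)
Require Import Defs.
From HB Require Import structures.
From mathcomp Require Import all_boot all_order all_algebra.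
From mathcomp Require Import boolp classical_sets cardinality.
From mathcomp Require Import mpoly.
From mathcomp Require Import zify ring.

Import Order.TTheory GRing.Theory Num.Theory.

Local Open Scope classical_set_scope.
Local Open Scope ring_scope.

(** The image [J] of [I] lies in [Zplus] because the pattern is admitted, and it
    is closed under addition because the form is additive and sums of
    non-increasing sequences of [I] are again such sequences.  Everything
    therefore turns on whether [J] contains all large integers: every ideal of
    a numerical semigroup does ([ideal_cofinite]), and conversely such a [J] is
    an ideal of [J `|` [set 0]].

    The gcd of the coefficients divides every element of [J].  If [J] contains
    two consecutive integers, as it does when it contains all large ones, the
    gcd is therefore [1].  If the gcd is [1], a Bezout relation
    [\sum_i a i * u i = 1] gives consecutive elements of [J]: a steeply
    decreasing sequence of large integers remains a non-increasing sequence of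
    [I] after [u] is added to it ([nonincreasing_perturbation]), and the form
    increases by exactly [1].  Two consecutive elements suffice for a set
    closed under addition to contain all large integers
    ([consecutive_cofinite]). *)

Lemma cofinite_bound (A : set int) :
  finite_set (Zplus `\` A) -> exists c, 0 <= c /\ forall x, c <= x -> A x.
Proof.
move=> /finite_seqP[r rE].
have r_le x : x \in r -> x <= \sum_(y <- r) `|y|.
  move=> xr; apply: (le_trans (ler_norm x)).
  by rewrite (big_rem x xr) /= lerDl sumr_ge0.
exists (\sum_(y <- r) `|y| + 1); split; first by rewrite addr_ge0 ?sumr_ge0.
move=> x lex; apply: contrapT => nAx.
have /r_le : x \in r.
  have : (Zplus `\` A) x.
    by split=> //; apply: le_trans lex; rewrite addr_ge0 ?sumr_ge0.
  by rewrite rE.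
lia.
Qed.

Lemma bound_cofinite (A : set int) (c : int) :
  (forall x, c <= x -> A x) -> finite_set (Zplus `\` A).
Proof.
move=> Ac; apply: (@sub_finite_set _ _ [set` [seq Posz k | k <- iota 0 `|c|]]).
  move=> x [x_ge0 nAx] /=; apply/mapP; exists `|x|%N; last by rewrite gez0_abs.
  rewrite mem_iota /=; have : ~ c <= x by move=> /Ac.
  move: x_ge0; rewrite /Zplus /=; lia.
exact: finite_seq.
Qed.

Lemma ideal_cofinite {S I : set int} :
  numerical_semigroup S -> ideal_of S I ->
  exists c, 0 <= c /\ forall x, c <= x -> I x.
Proof.
move=> [SZ _ _ /cofinite_bound[c [c_ge0 Sc]]] [[y Iy] IS ID].
have y_ge0 : 0 <= y by exact/SZ/IS.
exists (y + c); split; first by rewrite addr_ge0.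
by move=> x lex; rewrite -(subrKC y x); apply: ID => //; apply: Sc; lia.
Qed.

(** Sums of [m.+1] terms equal to [v] or [v + 1] fill the interval from
    [m.+1 * v] to [m.+1 * v + m.+1]; from [m.+1 = v] on, these intervals leave
    no gaps. *)
Lemma consecutive_cofinite (J : set int) (v : int) :
  0 <= v -> (forall x y, J x -> J y -> J (x + y)) -> J v -> J (v + 1) ->
  forall x, v * v <= x -> J x.
Proof.
case: v => // v _ JD Jv Jv1.
have Jint m k : (k <= m.+1)%N -> J (m.+1 * v + k)%N.
  elim: m k => [|m IHm] [|k] lek; rewrite ?addn0 ?mul1n //.
  - by have -> : k = 0%N by lia.
  - have := JD _ _ Jv (IHm 0%N isT).
    by congr J; lia.
  - have := JD _ _ Jv1 (IHm k lek).
    by congr J; lia.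
case=> [x|x] lex; last lia.
case: (posnP v) => [v0|v_gt0].
  (* Only the number of summands matters when [v = 0]; [x = 0] is [v] itself. *)
  case: x lex => [|x] _; first by rewrite -v0.
  by have := Jint x x.+1 (leqnn _); rewrite v0 muln0.
have leq : (v <= x %/ v)%N by rewrite leq_divRL //; lia.
rewrite (divn_eq x v) -(prednK (leq_trans v_gt0 leq)).
apply: Jint; rewrite prednK ?(leq_trans v_gt0 leq) //.
by rewrite ltnW // (leq_trans _ leq) // ltn_pmod.
Qed.

Lemma big_gcdz_dvd (n : nat) (a : 'I_n -> int) (i : 'I_n) :
  (\big[gcdz/0]_(j < n) a j %| a i)%Z.
Proof.
have : i \in index_enum 'I_n by rewrite mem_index_enum.
elim: (index_enum _) => // j r IHr; rewrite inE big_cons.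
case/predU1P=> [<-|/IHr]; first exact: dvdz_gcdl.
exact/dvdz_trans/dvdz_gcdr.
Qed.

Lemma big_gcdz_ge0 (n : nat) (a : 'I_n -> int) : 0 <= \big[gcdz/0]_(i < n) a i.
Proof. by apply: (big_rec (fun d : int => 0 <= d)). Qed.

Lemma big_gcdz_Bezout (n : nat) (a : 'I_n -> int) :
  exists u : 'I_n -> int, \sum_(i < n) a i * u i = \big[gcdz/0]_(i < n) a i.
Proof.
apply: (big_ind (fun d => exists u : 'I_n -> int, \sum_(i < n) a i * u i = d)).
- by exists (fun=> 0); apply: big1 => i _; rewrite mulr0.
- move=> x y [u <-] [w <-].
  have [k [l <-]] := Bezoutz (\sum_(i < n) a i * u i) (\sum_(i < n) a i * w i).
  exists (fun i => k * u i + l * w i); rewrite !mulr_sumr -big_split /=.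
  by apply: eq_bigr => i _; ring.
- move=> i _; exists (fun j => (j == i)%:R).
  rewrite (bigD1 i) //= eqxx mulr1 big1 ?addr0 // => j /negPf->.
  by rewrite mulr0.
Qed.

Lemma meval_linear_form (n : nat) (a s : 'I_n -> int) :
  (linear_form a).@[s] = \sum_(i < n) a i * s i.
Proof.
rewrite /linear_form raddf_sum /=; apply: eq_bigr => i _.
by rewrite mevalZ mevalXU.
Qed.

Lemma pattern_image_add (n : nat) (a : 'I_n -> int) (I : set int) :
  (forall x y, I x -> I y -> I (x + y)) ->
  forall x y, pattern_image (linear_form a) I x ->
    pattern_image (linear_form a) I y -> pattern_image (linear_form a) I (x + y).
Proof.
move=> ID _ _ [s [Is sle] <-] [t [It tle] <-].
exists (fun i => s i + t i).
  by split=> [i|i j leij]; [exact: ID | rewrite lerD ?sle ?tle].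
rewrite !meval_linear_form -big_split; apply: eq_bigr => i _.
by rewrite mulrDr.
Qed.

Lemma nonincreasing_perturbation (n : nat) (I : set int) (c : int)
    (u : 'I_n -> int) :
  (forall x, c <= x -> I x) ->
  exists s : 'I_n -> int,
    nonincreasing_in I s /\ nonincreasing_in I (fun i => s i + u i).
Proof.
move=> Ic; pose B := \sum_(i < n) `|u i|.
have uB i : `|u i| <= B by rewrite /B (bigD1 i) //= lerDl sumr_ge0.
have B_ge0 : 0 <= B by rewrite sumr_ge0.
(* Steps of [2 * B] absorb a difference of two entries of [u], and the offset
   [B] keeps the perturbed entries above [c]. *)
pose s (i : 'I_n) : int := c + B + 2 * B * (n - i)%N%:Z.
have step (i j : 'I_n) : (i < j)%N -> s j + 2 * B <= s i.
  move=> ltij; rewrite /s.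
  have : 2 * B * ((n - j)%N%:Z + 1) <= 2 * B * (n - i)%N%:Z.
    by apply: ler_wpM2l; have := ltn_ord j; lia.
  rewrite mulrDr mulr1; lia.
have s_ge i : c + B <= s i by rewrite lerDl mulr_ge0 ?mulr_ge0.
exists s; split; split=> [i|i j].
- by apply: Ic; have := s_ge i; lia.
- rewrite leq_eqVlt => /predU1P[/val_inj->//|/step]; lia.
- by apply: Ic; have := s_ge i; have := uB i; lia.
- rewrite leq_eqVlt => /predU1P[/val_inj->//|/step].
  have := uB i; have := uB j; lia.
Qed.

Theorem theorem3 (n : nat) (a : 'I_n -> int) (S I : set int)
    (hp : admits Zplus (linear_form a))
    (hS : numerical_semigroup S) (hI : ideal_of S I) :
  (exists T : set int,
      numerical_semigroup T /\ ideal_of T (pattern_image (linear_form a) I))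
  <-> \big[gcdz/0]_(i < n) a i = 1.
Proof.
set J := pattern_image _ _; split=> [[T [hT hJ]]|gcd1].
  have [c [_ Jc]] := ideal_cofinite hT hJ.
  have gcd_dvd x : J x -> (\big[gcdz/0]_(i < n) a i %| x)%Z.
    case=> s _ <-; rewrite meval_linear_form.
    by apply: rpred_sum => i _; apply: dvdz_mulr; apply: big_gcdz_dvd.
  have : (\big[gcdz/0]_(i < n) a i %| c + 1 - c)%Z.
    by apply: rpredB; apply: gcd_dvd; apply: Jc; rewrite ?lerDl.
  rewrite addrAC subrr add0r dvdz1 => /eqP gcd1.
  by rewrite -(gez0_abs (big_gcdz_ge0 n a)) gcd1.
have [c [_ Ic]] := ideal_cofinite hS hI.
have [SZ _ _ _] := hS; have [_ IS ID] := hI.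
have JZ : J `<=` Zplus.
  move=> _ [s [Is sle] <-]; apply: hp; split=> // i.
  exact/SZ/IS.
have JD : forall x y, J x -> J y -> J (x + y).
  by apply: pattern_image_add => x y Ix /IS; apply: ID.
have [u au1] := big_gcdz_Bezout n a.
have [s [s_in su_in]] := nonincreasing_perturbation n I c u Ic.
set v := (linear_form a).@[s].
have Jv : J v by exists s.
have Jv1 : J (v + 1).
  exists (fun i => s i + u i) => //.
  rewrite /v !meval_linear_form -gcd1 -au1 -big_split; apply: eq_bigr => i _.
  by rewrite mulrDr.
have Jlarge := consecutive_cofinite J v (JZ _ Jv) JD Jv Jv1.
exists (J `|` [set 0]); split; split.
- by move=> x [/JZ//|->]; rewrite /Zplus /=.
- by right.
- move=> x y [Jx|->] [Jy|->]; rewrite ?addr0 ?add0r; [left|left|left|right] => //.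
  exact: JD.
- by apply: (bound_cofinite _ (v * v)) => x /Jlarge; left.
- by exists v.
- by move=> x; left.
- by move=> x y Jx [/(JD _ _ Jx)//|->]; rewrite addr0.
Qed.
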